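(* Let $(\Omega,\Sigma,\mu)$ be a measure space, $X(\mu)$ a $\sigma$-order continuous quasi-Banach function space with the $\sigma$-property, $E$ a Banach space and $T\colon X(\mu)\to E$ a continuous linear operator. Then $[i]\colon X(\mu)\to L^1(m_T)$ is well defined, $T=I_{m_T}\circ[i]$, and $I_{m_T}\colon L^1(m_T)\to E$ is continuous. Moreover the factorization is optimal: if $\xi$ is a measure on $\Sigma$ with $\xi\ll\mu$, $Z(\xi)$ is a $\sigma$-order continuous quasi-Banach function space such that $[i]\colon X(\mu)\to Z(\xi)$ is well defined, and $S\colon Z(\xi)\to E$ is a continuous linear operator with $T=S\circ[i]$, then $[i]\colon Z(\xi)\to L^1(m_T)$ is well defined and $S=I_{m_T}\circ[i]$.
   Context: $L^0(\lambda)$: $\lambda$-a.e. classes of $\Sigma$-measurable real functions. An ideal function space $Y(\lambda)\subset L^0(\lambda)$ is a vector subspace with $f\in Y(\lambda)$, $|g|\le|f|$ a.e. $\Rightarrow g\in Y(\lambda)$. A quasi-norm satisfies $\|x\|=0\iff x=0$, $\|\alpha x\|=|\alpha|\|x\|$, $\|x+y\|\le K(\|x\|+\|y\|)$ for some $K\ge1$. A quasi-Banach function space is an ideal function space complete under a quasi-norm with $|f|\le|g|$ a.e. $\Rightarrow\|f\|\le\|g\|$; it is $\sigma$-order continuous if $f_n\downarrow0$ a.e. implies $\|f_n\|\downarrow0$. $\sigma$-property: $\Omega=\bigcup_n\Omega_n$, $\Omega_n\in\Sigma$, $\chi_{\Omega_n}\in X(\mu)$. For $\xi\ll\lambda$,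 $[i]$ maps the $\lambda$-class of $f$ to its $\xi$-class; ''$[i]\colon Y(\lambda)\to W(\xi)$ is well defined'' means $\xi\ll\lambda$ and the $\xi$-class of each $f\in Y(\lambda)$ lies in $W(\xi)$. $\Sigma_{X(\mu)}=\{A\in\Sigma:\chi_A\in X(\mu)\}$ ($\delta$-ring with local $\sigma$-algebra $\Sigma$), $m_T(A)=T(\chi_A)$ for $A\in\Sigma_{X(\mu)}$ (a vector measure under the hypotheses). For a vector measure $m$ on $\Sigma_{X(\mu)}$: $|x^*m|$ the variation of $x^*\circ m$ on $\Sigma$, $\|m\|=\sup_{x^*\in B_{E^*}}|x^*m|$, $L^0(m)$ = $\Sigma$-measurable functions modulo $\|m\|$-null sets; $L^1(m)$ = those $f\in L^0(m)$ with $f\in L^1(|x^*m|)$ for all $x^*$ and, for each $A\in\Sigma$, some $\int_Af\,dm\in E$ with $x^*(\int_Af\,dm)=\int_Af\,dx^*m$ for all $x^*$, normed by $\sup_{x^*\in B_{E^*}}\int|f|\,d|x^*m|$; $I_m(f)=\int_\Omega f\,dm$. *)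

(* Defs.v *)
From HB Require Import structures.
From mathcomp Require Import all_boot all_order all_algebra.
From mathcomp Require Import all_classical all_reals all_analysis.
Import Order.TTheory GRing.Theory Num.Theory.
Import numFieldNormedType.Exports.
Local Open Scope classical_set_scope.
Local Open Scope ring_scope.

Set Implicit Arguments.
Unset Strict Implicit.
Unset Printing Implicit Defensive.

(* quasi-Banach function space over (T, measurable, mu):
   functions (not classes) ; X : set of representatives, N : quasi-norm *)
Definition is_qBFS {d} {T : measurableType d} {R : realType}
  (mu : {measure set T -> \bar R}) (X : set (T -> R)) (N : (T -> R) -> R) : Prop :=
  [/\
      (forall f : T -> R, X f -> measurable_fun setT f) /\
      [/\ X (fun _ => 0),
          (forall f g : T -> R, X f -> X g -> X (fun x => f x + g x)) &
          (forall (a : R) (f : T -> R), X f -> X (fun x => a * f x))],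
      (forall f g : T -> R, X f -> measurable_fun setT g ->
          {ae mu, forall x, `|g x| <= `|f x|} -> X g),
      [/\ (forall f : T -> R, X f -> (N f = 0 <-> {ae mu, forall x, f x = 0})),
          (forall (a : R) (f : T -> R), X f -> N (fun x => a * f x) = `|a| * N f) &
          (exists K : R, (1 <= K /\ forall f g : T -> R, X f -> X g ->
              N (fun x => f x + g x) <= K * (N f + N g)))],
      (forall f g : T -> R, X f -> X g -> {ae mu, forall x, `|f x| <= `|g x|} -> N f <= N g) &
      (forall u : nat -> T -> R, (forall n, X (u n)) ->
         (forall e : R, 0 < e -> exists M : nat, forall n m, (M <= n)%N -> (M <= m)%N ->
             N (fun x => u n x - u m x) < e) ->
         exists2 g, X g & forall e : R, 0 < e -> exists M : nat, forall n, (M <= n)%N ->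
             N (fun x => u n x - g x) < e)].

Definition sigma_oc {d} {T : measurableType d} {R : realType}
  (mu : {measure set T -> \bar R}) (X : set (T -> R)) (N : (T -> R) -> R) : Prop :=
  forall u : nat -> T -> R, (forall n, X (u n)) ->
    {ae mu, forall x, (forall n, u n.+1 x <= u n x) /\ u n x @[n --> \oo] --> 0} ->
    N (u n) @[n --> \oo] --> 0.

Definition sigma_prop {d} {T : measurableType d} {R : realType}
  (X : set (T -> R)) : Prop :=
  exists O : nat -> set T, (forall n, measurable (O n)) /\
    \bigcup_n O n = setT /\ forall n, X (\1_(O n) : T -> R).

Definition cont_lin_op {R : realType} {T : Type} {E : normedModType R}
  (X : set (T -> R)) (N : (T -> R) -> R) (S : (T -> R) -> E) : Prop :=
  [/\ (forall f g : T -> R, X f -> X g -> S (fun x => f x + g x) = S f + S g),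
      (forall (a : R) (f : T -> R), X f -> S (fun x => a * f x) = a *: S f) &
      (forall f : T -> R, X f -> forall e : R, 0 < e -> exists2 del : R, 0 < del &
          forall g, X g -> N (fun x => g x - f x) < del -> `|S g - S f| < e)].

Definition abs_cont {d} {T : measurableType d} {R : realType}
  (xi mu : set T -> \bar R) : Prop :=
  forall A, measurable A -> mu A = 0%E -> xi A = 0%E.

Definition is_dual {R : realType} {E : normedModType R} (x : E -> R) : Prop :=
  (forall (a : R) (u v : E), x (a *: u + v) = a * x u + x v) /\ continuous x.

Definition dual_ball {R : realType} {E : normedModType R} (x : E -> R) : Prop :=
  is_dual x /\ forall u : E, `|x u| <= `|u|.

Definition SigmaX {d} {T : measurableType d} {R : realType}
  (X : set (T -> R)) : set (set T) :=
  [set A | measurable A /\ X (\1_A : T -> R)].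

Definition mT {T : Type} {R : realType} {E : normedModType R}
  (S : (T -> R) -> E) : set T -> E := fun A => S (\1_A : T -> R).

(* For a real set function lam on a delta-ring Rg, its variation, positive
   and negative variations, extended to all of Sigma *)
Definition variation {T : Type} {R : realType}
  (Rg : set (set T)) (lam : set T -> R) (A : set T) : \bar R :=
  ereal_sup [set r : \bar R | exists (n : nat) (F : nat -> set T),
     [/\ (forall i, (i < n)%N -> Rg (F i) /\ F i `<=` A),
         trivIset `I_n F &
         r = (\sum_(i < n) `|lam (F i)|)%:E]].

Definition posvar {T : Type} {R : realType}
  (Rg : set (set T)) (lam : set T -> R) (A : set T) : \bar R :=
  ereal_sup [set (lam B)%:E | B in [set B | Rg B /\ B `<=` A]].

Definition negvar {T : Type} {R : realType}
  (Rg : set (set T)) (lam : set T -> R) (A : set T) : \bar R :=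
  ereal_sup [set (- lam B)%:E | B in [set B | Rg B /\ B `<=` A]].

Definition sint {d} {T : measurableType d} {R : realType}
  (Rg : set (set T)) (lam : set T -> R) (A : set T) (f : T -> R) : \bar R :=
  (\int[posvar Rg lam]_(x in A) (f x)%:E - \int[negvar Rg lam]_(x in A) (f x)%:E)%E.

Definition xm {T : Type} {R : realType} {E : normedModType R}
  (x : E -> R) (m : set T -> E) : set T -> R := fun A => x (m A).

Definition mnull {T : Type} {R : realType} {E : normedModType R}
  (Rg : set (set T)) (m : set T -> E) (A : set T) : Prop :=
  forall x : E -> R, dual_ball x -> variation Rg (xm x m) A = 0%E.

Definition vL1 {d} {T : measurableType d} {R : realType} {E : normedModType R}
  (Rg : set (set T)) (m : set T -> E) : set (T -> R) :=
  [set f : T -> R | [/\ measurable_fun setT f,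
     (forall x : E -> R, is_dual x ->
        (\int[variation Rg (xm x m)]_(t in setT) (`|f t|)%:E < +oo)%E) &
     (forall A, measurable A -> exists e : E, forall x : E -> R, is_dual x ->
        (x e)%:E = sint Rg (xm x m) A f)]].

Definition vL1norm {d} {T : measurableType d} {R : realType} {E : normedModType R}
  (Rg : set (set T)) (m : set T -> E) (f : T -> R) : \bar R :=
  ereal_sup [set (\int[variation Rg (xm x m)]_(t in setT) (`|f t|)%:E)%E
               | x in [set x : E -> R | dual_ball x]].

(* I_m(f) = int_Omega f dm (the unique such vector, by Hahn-Banach) *)
Definition Ivec {d} {T : measurableType d} {R : realType} {E : normedModType R}
  (Rg : set (set T)) (m : set T -> E) (f : T -> R) : E :=
  xget 0 [set e : E | forall x : E -> R, is_dual x ->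
                        (x e)%:E = sint Rg (xm x m) setT f].

(* Main.v *)
(**
Both halves are the same statement about an arbitrary [Z] and [S] that agree
with [T] on the indicators of the delta-ring [SigmaX X]; the first half is the
case [Z = X].

For [x] in the dual of [E], the scalar measure [x \o m_T] is [L \1_A] for the
functional [L f = x (S f)], which is sigma-order continuous on [Z].  Hahn
decompositions on the pieces of a disjoint cover by sets of the delta-ring glue
to a global one, so the positive and negative variations are given on the
delta-ring by two order continuous functionals, namely [L] restricted to the two
parts of the decomposition, up to sign.  A nonnegative [f] in [Z] is the
increasing limit of simple functions supported in the delta-ring; monotone
convergence on one side and order continuity on the other show that its
integrals against the variations are values of these functionals.  They are
therefore finite, and [x (S (f \1_A))] is the integral of [f] over [A] against
[x \o m_T].  Hahn-Banach turns this into uniqueness of the vector integral and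
into the bound [`|I_m f| <= vL1norm f].
*)
Require Import Defs.
From HB Require Import structures.
From mathcomp Require Import all_boot all_order all_algebra.
From mathcomp Require Import all_classical all_reals all_analysis.
From mathcomp Require Import measurable_realfun lra.
Import Order.TTheory GRing.Theory Num.Theory.
Import numFieldNormedType.Exports.
Local Open Scope classical_set_scope.
Local Open Scope ring_scope.

Set Implicit Arguments.
Unset Strict Implicit.
Unset Printing Implicit Defensive.

(** * Hahn-Banach: norming functionals *)

(** Partial functionals are encoded as graphs, so that the union of a chain is a plain union of
    sets. Single-valuedness is not part of the definition: it follows from domination. *)
Definition dominated_linear_graph (R : realType) (E : normedModType R)
    (G : set (E * R)) : Prop :=
  (forall (a : R) u r v s, G (u, r) -> G (v, s) -> G (a *: u + v, a * r + s)) /\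
  (forall u r, G (u, r) -> r <= `|u|).

(** The value [c] at [v] has to lie above every [r - |u - v|] and below every [|u + v| - r]. The
    triangle inequality separates the two families, and [c] is the supremum of the lower one. For
    [a] nonzero, dividing by [|a|] reduces domination to one of these bounds, according to the sign
    of [a]. *)
Lemma dominated_linear_graph_extend (R : realType) (E : normedModType R)
    (G : set (E * R)) (v : E) :
  dominated_linear_graph G -> G !=set0 ->
  exists c : R, dominated_linear_graph
    [set w | exists u r a, G (u, r) /\ w = (u + a *: v, r + a * c)].
Proof.
move=> [Glin Gdom] [[u0 r0] G0].
have Gscale (a : R) u r : G (u, r) -> G (a *: u, a * r).
  move=> Gu; have := Glin (-1) _ _ _ _ Gu Gu.
  rewrite scaleN1r mulN1r !addNr => G00.
  by have := Glin a _ _ _ _ Gu G00; rewrite !addr0.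
pose L := [set z : R | exists u r, G (u, r) /\ z = r - `|u - v|].
have L_le u r z : G (u, r) -> L z -> z <= `|u + v| - r.
  move=> Gu [u' [r' [Gu' ->]]].
  have := Gdom _ _ (Glin 1 _ _ _ _ Gu Gu'); rewrite scale1r mul1r => h.
  have : `|u + u'| <= `|u + v| + `|u' - v|.
    by apply: le_trans (ler_normD _ _); rewrite addrACA subrr addr0.
  lra.
have L0 : L !=set0 by exists (r0 - `|u0 - v|), u0, r0.
have Lsup : has_sup L by split=> //; exists (`|u0 + v| - r0) => z; exact: L_le.
exists (sup L); split.
  move=> b _ _ _ _ [u [r [a [Gu [-> ->]]]]] [u' [r' [a' [Gu' [-> ->]]]]].
  exists (b *: u + u'), (b * r + r'), (b * a + a'); split; first exact: Glin.
  by congr (_, _); [rewrite scalerDr scalerDl scalerA addrACA|lra].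
move=> _ _ [u [r [a [Gu [-> ->]]]]].
have [a0|a0|->] := ltgtP a 0; last by rewrite scale0r mul0r !addr0; exact: Gdom.
- have b0 : 0 < - a by rewrite oppr_gt0.
  have uE : u + a *: v = (- a) *: ((- a)^-1 *: u - v).
    by rewrite scalerBr scalerA divff ?gt_eqF// scale1r scaleNr opprK.
  have : L ((- a)^-1 * r - `|(- a)^-1 *: u - v|).
    by exists ((- a)^-1 *: u), ((- a)^-1 * r); split => //; exact: Gscale.
  move=> /(ub_le_sup Lsup.2); rewrite -(ler_pM2l b0) mulrBr mulrA divff ?gt_eqF//.
  rewrite uE normrZ (gtr0_norm b0); lra.
- have uE : u + a *: v = a *: (a^-1 *: u + v).
    by rewrite scalerDr scalerA divff ?gt_eqF// scale1r.
  have : sup L <= `|a^-1 *: u + v| - a^-1 * r.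
    by apply: ge_sup => // z; apply: L_le; exact: Gscale.
  rewrite -(ler_pM2l a0) mulrBr mulrA divff ?gt_eqF// uE normrZ (gtr0_norm a0); lra.
Qed.

(** Zorn's lemma is applied to dominated graphs through the point [(e, |e|)]; the one-step extension
    shows that a maximal one has full domain. Domination at [u] and at [- u] bounds the functional
    by the norm, hence also gives continuity. *)
Lemma exists_norming_functional (R : realType) (E : normedModType R) (e : E) :
  exists x : E -> R, dual_ball x /\ x e = `|e|.
Proof.
pose L0 : set (E * R) := [set w | exists a : R, w = (a *: e, a * `|e|)].
have domL0 : dominated_linear_graph L0.
  split=> [b _ _ _ _ [a [-> ->]] [a' [-> ->]]|_ _ [a [-> ->]]].
    by exists (b * a + a'); rewrite scalerA scalerDl mulrDl !mulrA.
  by rewrite normrZ ler_wpM2r// ler_norm.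
have L0e : L0 (e, `|e|) by exists 1; rewrite scale1r mul1r.
pose P (G : set (E * R)) :=
  dominated_linear_graph G /\ (G !=set0 -> G (e, `|e|)).
have [F FP totF|G [[[Glin Gdom] Ge] Gmax]] := @Zorn_bigcup _ P.
  split; first split.
  - move=> a u r v s [A FA Au] [B FB Bv].
    have [AB|BA] := totF _ _ FA FB.
      by exists B => //; apply: (FP _ FB).1.1 => //; exact: AB.
    by exists A => //; apply: (FP _ FA).1.1 => //; exact: BA.
  - by move=> u r [A FA Au]; exact: (FP _ FA).1.2 Au.
  - by move=> [w [A FA Aw]]; exists A => //; apply: (FP _ FA).2; exists w.
have G0 : G !=set0.
  apply/set0P/negP => /eqP G0; apply: (Gmax L0); last by split.
  by rewrite G0; split=> // /(_ _ L0e).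
have {}Ge := Ge G0.
(* Domination at the point [(0, r - s)] of [G]; exchanging [r] and [s] makes [G] single-valued. *)
have Gfun u r s : G (u, r) -> G (u, s) -> r <= s.
  move=> Gr Gs; have := Gdom _ _ (Glin (-1) _ _ _ _ Gs Gr).
  by rewrite scaleN1r addNr normr0; lra.
have G00 : G (0, 0).
  by have := Glin (-1) _ _ _ _ Ge Ge; rewrite scaleN1r mulN1r !addNr.
have Gtot v : exists r, G (v, r).
  have [c domc] := dominated_linear_graph_extend v (conj Glin Gdom) G0.
  set H := [set w | _] in domc.
  have GH : G `<=` H by move=> [u r] Gu; exists u, r, 0; rewrite scale0r mul0r !addr0.
  apply: contrapT => nG; apply: (Gmax H); last by split => // _; exact: GH.
  split=> // HG; apply: nG; exists c; apply: HG.
  by exists 0, 0, 1; rewrite scale1r mul1r !add0r.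
have [x Gx] := choice Gtot.
have xE u r : G (u, r) -> x u = r.
  by move=> Gu; apply/eqP; rewrite eq_le !(Gfun u).
have xlin (a : R) u v : x (a *: u + v) = a * x u + x v by apply: xE; exact: Glin.
have x_le u : `|x u| <= `|u|.
  rewrite ler_norml (Gdom _ _ (Gx u)) andbT lerNl.
  have := xlin (-1) u 0; rewrite addr0 scaleN1r (xE _ _ G00) addr0 mulN1r => <-.
  by rewrite -normrN; exact: Gdom.
exists x; split; last exact: xE.
split=> //; split=> // u; apply/cvgrPdist_lt => /= eps eps0.
near=> v.
have -> : x u - x v = x (u - v).
  by have := xlin (-1) v u; rewrite scaleN1r (addrC (- v)) => ->; lra.
apply: le_lt_trans (x_le _) _; near: v.
by apply: cvgr_dist_lt => //; exact: cvg_id.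
Unshelve. all: by end_near. Qed.

(** * Positive, negative and total variation on an ideal of measurable sets *)

Definition ring_ideal d (T : measurableType d) (Rg : set (set T)) : Prop :=
  [/\ Rg `<=` measurable, Rg set0,
      (forall A B, Rg A -> measurable B -> B `<=` A -> Rg B) &
      (forall A B, Rg A -> Rg B -> Rg (A `|` B))].

Definition additive_on (T : Type) (R : realType) (Rg : set (set T))
    (lam : set T -> R) : Prop :=
  forall A B, Rg A -> Rg B -> A `&` B = set0 -> lam (A `|` B) = lam A + lam B.

Definition sigma_additive_on (T : Type) (R : realType) (Rg : set (set T))
    (lam : set T -> R) : Prop :=
  forall F : nat -> set T, (forall n, Rg (F n)) -> trivIset setT F ->
    Rg (\bigcup_n F n) ->
    \sum_(0 <= i < n) lam (F i) @[n --> \oo] --> lam (\bigcup_n F n).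

Lemma additive_onN (T : Type) (R : realType) (Rg : set (set T)) (lam : set T -> R) :
  additive_on Rg lam -> additive_on Rg (fun A => - lam A).
Proof. by move=> lamD A B RA RB AB; rewrite lamD// opprD. Qed.

Lemma sigma_additive_onN (T : Type) (R : realType) (Rg : set (set T))
    (lam : set T -> R) :
  sigma_additive_on Rg lam -> sigma_additive_on Rg (fun A => - lam A).
Proof.
move=> lamD F RF tF RU; under eq_fun do rewrite sumrN.
by apply: cvgN; exact: lamD.
Qed.

Lemma additive_on_set0 (T : Type) (R : realType) (Rg : set (set T))
    (lam : set T -> R) : Rg set0 -> additive_on Rg lam -> lam set0 = 0.
Proof.
by move=> R0 lamD; have := lamD _ _ R0 R0 (setI0 _); rewrite setU0; lra.
Qed.

Section positive_variation.
Context d (T : measurableType d) (R : realType).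
Variables (Rg : set (set T)).
Hypothesis RgI : ring_ideal Rg.
Implicit Types (lam : set T -> R) (A B : set T).

Lemma ring_ideal_setI A B : Rg A -> measurable B -> Rg (A `&` B).
Proof.
move=> RA mB; have [mR _ Rsub _] := RgI.
by apply: (Rsub A) => //; apply: measurableI => //; apply: mR.
Qed.

Lemma ring_ideal_setD A B : Rg A -> measurable B -> Rg (A `\` B).
Proof. by move=> RA mB; rewrite setDE; apply/ring_ideal_setI/measurableC. Qed.

Lemma additive_on_split lam A B : additive_on Rg lam -> Rg A -> measurable B ->
  lam A = lam (A `&` B) + lam (A `\` B).
Proof.
move=> lamD RA mB; rewrite -lamD; first by rewrite setUIDK.
- exact: ring_ideal_setI.
- exact: ring_ideal_setD.
- by rewrite setDE setIACA setICr setI0.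
Qed.

Lemma posvar_ub lam A B : Rg B -> B `<=` A -> ((lam B)%:E <= posvar Rg lam A)%E.
Proof. by move=> RB BA; apply: ereal_sup_ubound; exists B. Qed.

Lemma posvar_le lam A (M : \bar R) :
  (forall B, Rg B -> B `<=` A -> ((lam B)%:E <= M)%E) -> (posvar Rg lam A <= M)%E.
Proof. by move=> lamM; apply: ge_ereal_sup => _ [B [RB BA] <-]; exact: lamM. Qed.

Lemma le_posvar lam A B : A `<=` B -> (posvar Rg lam A <= posvar Rg lam B)%E.
Proof.
by move=> AB; apply: posvar_le => C RC CA; apply: posvar_ub => //; exact: subset_trans AB.
Qed.

Lemma posvar_ge0 lam A : additive_on Rg lam -> (0 <= posvar Rg lam A)%E.
Proof.
move=> lamD; have [_ R0 _ _] := RgI.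
have := @posvar_ub lam A set0 R0 (@sub0set _ _).
by rewrite (additive_on_set0 R0 lamD).
Qed.

(** Competitors inside [A] and inside [B] are disjoint, so their union is a competitor inside the
    union. The suprema are taken one after the other, and the case of an infinite value on [B] is
    separated because it cannot be subtracted. *)
Lemma posvar_superadditive lam A B : additive_on Rg lam -> A `&` B = set0 ->
  (posvar Rg lam A + posvar Rg lam B <= posvar Rg lam (A `|` B))%E.
Proof.
move=> lamD AB; have [_ _ _ RU] := RgI.
have lamB C : Rg C -> C `<=` A ->
    ((lam C)%:E + posvar Rg lam B <= posvar Rg lam (A `|` B))%E.
  move=> RC CA; rewrite addeC -leeBrDr//; apply: posvar_le => D RD DB.
  rewrite leeBrDr// -EFinD addrC -lamD//.
    by apply: posvar_ub; [exact: RU|exact: setUSS].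
  by apply/seteqP; split => // x [/CA Ax /DB Bx]; rewrite -AB.
have := posvar_ge0 B lamD; case E : (posvar Rg lam B) => [b| |] // b0.
  rewrite -leeBrDr//; apply: posvar_le => C RC CA.
  by rewrite leeBrDr// -E; exact: lamB.
suff -> : posvar Rg lam (A `|` B) = +oo%E by rewrite leey.
by apply/eqP; rewrite -leye_eq -E; apply: le_posvar; exact: subsetUr.
Qed.

Lemma posvar_superadditive_sum lam (F : nat -> set T) n : additive_on Rg lam ->
  trivIset `I_n F ->
  (\sum_(i < n) posvar Rg lam (F i) <= posvar Rg lam (\big[setU/set0]_(i < n) F i))%E.
Proof.
move=> lamD; elim: n => [|n IH] tF; first by rewrite !big_ord0 posvar_ge0.
have {}IH := IH (sub_trivIset (fun i (h : (i < n)%N) => ltnW h) tF).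
rewrite !big_ord_recr /=; apply: le_trans (posvar_superadditive lamD _).
  exact: leeD2r.
rewrite -bigcup_mkord; apply/seteqP; split => // x [[i /= ni Fix] Fnx].
by move: (ni); rewrite (tF i n) ?ltnn//=; [exact: ltnW|exists x].
Qed.

(** Superadditivity bounds the partial sums by the value on the union. Conversely a competitor [B]
    is cut along the [F n], and sigma-additivity of [lam] recovers [lam B] from the pieces. Since
    [negvar] of [lam] is by definition [posvar] of [- lam], the negative variation is covered
    too. *)
Lemma posvar_measure lam : additive_on Rg lam -> sigma_additive_on Rg lam ->
  exists p : {measure set T -> \bar R}, (p : set T -> \bar R) = posvar Rg lam.
Proof.
move=> lamD lams; have [_ R0 _ _] := RgI.
have p0 : posvar Rg lam set0 = 0%E.
  apply/eqP; rewrite eq_le posvar_ge0// andbT; apply: posvar_le => B _.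
  by rewrite subset0 => ->; rewrite (additive_on_set0 R0 lamD).
have p_ge0 A : (0 <= posvar Rg lam A)%E by exact: posvar_ge0.
have ps : semi_sigma_additive (posvar Rg lam).
  move=> F mF tF mU.
  have cvgp : cvgn (fun n => \sum_(0 <= i < n) posvar Rg lam (F i))%E.
    exact: is_cvg_nneseries.
  suff <- : limn (fun n => \sum_(0 <= i < n) posvar Rg lam (F i))%E =
      posvar Rg lam (\bigcup_n F n) by [].
  apply/eqP; rewrite eq_le; apply/andP; split.
    apply: lime_le => //; apply: nearW => n; rewrite big_mkord.
    apply: le_trans (posvar_superadditive_sum lamD (sub_trivIset _ tF)) _ => //.
    by apply: le_posvar; exact: bigsetU_bigcup.
  apply: posvar_le => B RB BU.
  have RBF n : Rg (B `&` F n) by exact: ring_ideal_setI.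
  have BE : \bigcup_n (B `&` F n) = B by rewrite -setI_bigcupr setIidl.
  have cB : (\sum_(0 <= i < n) lam (B `&` F i))%:E @[n --> \oo] --> (lam B)%:E.
    apply: cvg_EFin; first exact: nearW.
    by rewrite -{2}BE; apply: lams; rewrite ?BE//; exact: trivIset_setIl.
  rewrite -(cvg_lim _ cB)//; apply: lee_lim => //.
    by apply/cvg_ex; eexists; exact: cB.
  apply: nearW => n; rewrite -sumEFin; apply: lee_sum => i _.
  by apply: posvar_ub => //; exact: subIsetr.
by exists (HB.pack_for {measure set T -> \bar R} (posvar Rg lam)
  (isMeasure.Build _ _ _ (posvar Rg lam) p0 p_ge0 ps)).
Qed.

(** Upper bound: each [|lam (F i)|] is at most the positive or the negative variation of [F i],
    according to its sign. Lower bound: [lam B - lam C] equals [lam (B \ C) - lam (C \ B)], so the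
    disjoint pair [B \ C], [C \ B] is a competitor for the variation. *)
Lemma variationE lam A : additive_on Rg lam ->
  Defs.variation Rg lam A = (posvar Rg lam A + negvar Rg lam A)%E.
Proof.
move=> lamD; have [mR R0 _ _] := RgI.
have lamN := additive_onN lamD.
have negE : negvar Rg lam = posvar Rg (fun B => - lam B) by [].
have n_ge0 : (0 <= negvar Rg lam A)%E by exact: posvar_ge0.
apply/eqP; rewrite eq_le; apply/andP; split.
  apply: ge_ereal_sup => _ [n [F [RF tF ->]]].
  have UA : \big[setU/set0]_(i < n) F i `<=` A.
    by rewrite -bigcup_mkord => x [i /= ni Fx]; exact: (RF _ ni).2 Fx.
  apply: (@le_trans _ _ (\sum_(i < n) posvar Rg lam (F i) +
                         \sum_(i < n) negvar Rg lam (F i))%E).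
    rewrite -big_split/= -sumEFin; apply: lee_sum => i _.
    have [lam0|lam0] := leP 0 (lam (F i)).
      rewrite ger0_norm//; apply: le_trans (leeDl _ _); last exact: posvar_ge0.
      by apply: posvar_ub => //; exact: (RF _ _).1.
    rewrite ltr0_norm//; apply: le_trans (leeDr _ _); last exact: posvar_ge0.
    by rewrite negE; apply: posvar_ub => //; exact: (RF _ _).1.
  apply: leeD.
    by apply: le_trans (posvar_superadditive_sum _ _) (le_posvar _ UA).
  by apply: le_trans (posvar_superadditive_sum _ _) (le_posvar _ UA).
have var2 B C : Rg B -> B `<=` A -> Rg C -> C `<=` A ->
    ((lam B)%:E + (- lam C)%:E <= Defs.variation Rg lam A)%E.
  move=> RB BA RC CA.
  apply: (@le_trans _ _ (`|lam (B `\` C)| + `|lam (C `\` B)|)%:E).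
    rewrite -EFinD lee_fin (additive_on_split lamD RB (mR _ RC)).
    rewrite (additive_on_split lamD RC (mR _ RB)) (setIC C).
    have := ler_norm (lam (B `\` C)); have := ler_norm (- lam (C `\` B)).
    rewrite normrN; lra.
  apply: ereal_sup_ubound.
  exists 2%N, (fun i => if i == 0%N then B `\` C else C `\` B); split.
  - move=> i _; case: ifP => _; split.
    + by apply: ring_ideal_setD => //; exact: mR.
    + by apply: subset_trans BA; exact: subDsetl.
    + by apply: ring_ideal_setD => //; exact: mR.
    + by apply: subset_trans CA; exact: subDsetl.
  - move=> [|[|//]] [|[|//]] //= _ _ [x].
      by move=> [[Bx nCx] [Cx nBx]].
    by move=> [[Cx nBx] [Bx nCx]].
  - by rewrite !big_ord_recl big_ord0 /= addr0.
have varn B : Rg B -> B `<=` A ->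
    ((lam B)%:E + negvar Rg lam A <= Defs.variation Rg lam A)%E.
  move=> RB BA; rewrite addeC -leeBrDr// negE; apply: posvar_le => C RC CA.
  by rewrite leeBrDr// addeC; exact: var2.
move: varn n_ge0; case E : (negvar Rg lam A) => [b| |] // varn b0.
  by rewrite -leeBrDr//; apply: posvar_le => C RC CA; rewrite leeBrDr//; exact: varn.
have := varn _ R0 (@sub0set _ _); rewrite (additive_on_set0 R0 lamD) add0e.
by rewrite leye_eq => /eqP ->; rewrite leey.
Qed.

End positive_variation.

(** * Hahn decomposition relative to an ideal of sets *)

Definition sigma_covered (T : Type) (Rg : set (set T)) : Prop :=
  exists O : nat -> set T, (forall n, Rg (O n)) /\ \bigcup_n O n = setT.

Section hahn_decomposition_on_ideal.
Context d (T : measurableType d) (R : realType).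
Variables (Rg : set (set T)).
Hypothesis RgI : ring_ideal Rg.
Implicit Types (lam : set T -> R) (A B D P : set T).

(** As the ideal is hereditary, the trace of [lam] on [D] is a finite charge on the whole
    sigma-algebra, to which the classical Hahn decomposition applies. *)
Lemma hahn_decomposition_below lam D :
  additive_on Rg lam -> sigma_additive_on Rg lam -> Rg D ->
  exists P, [/\ measurable P,
    (forall C, Rg C -> C `<=` D `&` P -> 0 <= lam C) &
    (forall C, Rg C -> C `<=` D `\` P -> lam C <= 0)].
Proof.
move=> lamD lams RD; have [mR R0 _ _] := RgI.
pose nu A : \bar R := (lam (D `&` A))%:E.
have nu0 : nu set0 = 0%E by rewrite /nu setI0 (additive_on_set0 R0 lamD).
have nufin A : measurable A -> nu A \is a fin_num by [].
have nus : semi_sigma_additive nu.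
  move=> F mF tF mU; apply: cvg_EFin.
    by apply: nearW => n; rewrite sumEFin.
  under eq_fun do rewrite /= sumEFin /=.
  rewrite setI_bigcupr; apply: lams.
  - by move=> n; exact: ring_ideal_setI.
  - exact: trivIset_setIl.
  - by rewrite -setI_bigcupr; exact: ring_ideal_setI.
have [P [N [[mP posP] [mN negN] PN _]]] := Hahn_decomposition
  (HB.pack_for (charge T R) nu
     (isCharge.Build _ _ _ nu nu0 nufin nus)).
exists P; split => // C RC CDP; have mC := mR _ RC.
  have /= := posP C mC (fun x Cx => (CDP x Cx).2).
  by rewrite lee_fin setIidr// => x /CDP[].
have CN : C `<=` N.
  move=> x /CDP[_ nPx]; have : (P `|` N) x by rewrite PN.
  by case.
have /= := negN C mC CN.
by rewrite lee_fin setIidr// => x /CDP[].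
Qed.

Lemma sigma_additive_on_ge0 lam (D : nat -> set T) A :
  sigma_additive_on Rg lam -> (forall n, Rg (D n)) -> trivIset setT D ->
  A `<=` \bigcup_n D n -> Rg A -> (forall n, 0 <= lam (A `&` D n)) -> 0 <= lam A.
Proof.
move=> lams RD tD AD RA lam0; have [mR _ _ _] := RgI.
have AE : \bigcup_n (A `&` D n) = A by rewrite -setI_bigcupr setIidl.
have : \sum_(0 <= i < n) lam (A `&` D i) @[n --> \oo] --> lam A.
  rewrite -[in X in _ --> X]AE; apply: lams; rewrite ?AE//.
  - by move=> n; apply: ring_ideal_setI => //; exact: mR.
  - exact: trivIset_setIl.
move=> cA; rewrite -(cvg_lim _ cA)//; apply: limr_ge.
  by apply/cvg_ex; eexists; exact: cA.
by apply: nearW => n; exact: sumr_ge0.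
Qed.

Lemma hahn_decomposition_on lam : sigma_covered Rg ->
  additive_on Rg lam -> sigma_additive_on Rg lam ->
  exists P, [/\ measurable P,
    (forall C, Rg C -> C `<=` P -> 0 <= lam C) &
    (forall C, Rg C -> C `<=` ~` P -> lam C <= 0)].
Proof.
move=> [U [RU UT]] lamD lams; have [mR _ Rsub _] := RgI.
pose D := seqDU U.
have RD n : Rg (D n).
  apply: (Rsub (U n)) => //; last exact: subDsetl.
  apply: measurableD; first exact: mR.
  by apply: bigsetU_measurable => i _; exact: mR.
have tD : trivIset setT D by exact: trivIset_seqDU.
have DT : \bigcup_n D n = setT by rewrite -seqDU_bigcup_eq.
have [P HP] := choice (fun n => hahn_decomposition_below lamD lams (RD n)).
(* By disjointness the glued set coincides with [P n] on [D n]. *)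
have PD n x : D n x -> (\bigcup_k (D k `&` P k)) x -> P n x.
  by move=> Dx [k _ [Dkx Pkx]]; rewrite (tD n k)//; exists x.
exists (\bigcup_n (D n `&` P n)); split.
- apply: bigcup_measurable => n _; apply: measurableI; first exact: mR.
  by have [] := HP n.
- move=> C RC CP; apply: (sigma_additive_on_ge0 lams RD) => //; first by rewrite DT.
  move=> n; have [_ posP _] := HP n; apply: posP.
    by apply: ring_ideal_setI => //; exact: mR.
  by move=> x [/CP CPx Dx]; split=> //; exact: PD.
- move=> C RC CP; rewrite -oppr_ge0.
  apply: (sigma_additive_on_ge0 (sigma_additive_onN lams) RD) => //.
    by rewrite DT.
  move=> n; rewrite oppr_ge0; have [_ _ negP] := HP n; apply: negP.
    by apply: ring_ideal_setI => //; exact: mR.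
  by move=> x [/CP CPx Dx]; split=> // Px; apply: CPx; exists n.
Qed.

(** For [C] inside [B], discarding [C \ P] does not decrease [lam], and neither does enlarging the
    rest to all of the part of [B] in [P]; so this part attains the supremum. *)
Lemma posvar_hahn lam P B : additive_on Rg lam -> measurable P ->
  (forall C, Rg C -> C `<=` P -> 0 <= lam C) ->
  (forall C, Rg C -> C `<=` ~` P -> lam C <= 0) ->
  Rg B -> posvar Rg lam B = (lam (B `&` P))%:E.
Proof.
move=> lamD mP lamP lamN RB; have [mR _ _ _] := RgI.
apply/eqP; rewrite eq_le; apply/andP; split; last first.
  by apply: posvar_ub; [exact: ring_ideal_setI|exact: subIsetl].
apply: posvar_le => C RC CB; rewrite lee_fin.
have RBP : Rg (B `&` P) by exact: ring_ideal_setI.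
rewrite (additive_on_split RgI lamD RC mP) (additive_on_split RgI lamD RBP (mR _ RC)).
rewrite -setIA (setIC P) setIA (setIidr CB).
have : lam (C `\` P) <= 0 by apply: lamN; [exact: ring_ideal_setD|exact: subIsetr].
have : 0 <= lam ((B `&` P) `\` C).
  by apply: lamP; [apply: ring_ideal_setD => //; exact: mR|move=> x [[]]].
lra.
Qed.

End hahn_decomposition_on_ideal.

(** * Integrals as values of order continuous functionals *)

(** Domination is required at every point, so no measure enters; an ideal for almost everywhere
    domination qualifies. *)
Definition solid_space d (T : measurableType d) (R : realType)
    (Z : set (T -> R)) : Prop :=
  [/\ (forall f, Z f -> measurable_fun setT f), Z (fun=> 0),
      (forall f g, Z f -> Z g -> Z (fun x => f x + g x)),
      (forall a f, Z f -> Z (fun x => a * f x)) &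
      (forall f g : T -> R, Z f -> measurable_fun setT g ->
         (forall x, `|g x| <= `|f x|) -> Z g)].

Definition order_continuous_functional (T : Type) (R : realType)
    (Z : set (T -> R)) (L : (T -> R) -> R) : Prop :=
  [/\ (forall f g, Z f -> Z g -> L (fun x => f x + g x) = L f + L g),
      (forall a f, Z f -> L (fun x => a * f x) = a * L f) &
      (forall u : nat -> T -> R, (forall n, Z (u n)) ->
         (forall n x, u n.+1 x <= u n x) -> (forall x, u n x @[n --> \oo] --> 0) ->
         L (u n) @[n --> \oo] --> 0)].

Section integral_of_functional.
Import HBNNSimple.
Context d (T : measurableType d) (R : realType).
Variables (Z : set (T -> R)) (L : (T -> R) -> R) (Rg : set (set T)).
Variable p : {measure set T -> \bar R}.
Hypotheses (Zsolid : solid_space Z) (Locf : order_continuous_functional Z L).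
Hypotheses (RgI : ring_ideal Rg) (RgZ : forall B, Rg B -> Z (\1_B)).
Hypothesis pE : forall B, Rg B -> p B = (L (\1_B))%:E.

Lemma functional0 : L (fun=> 0) = 0.
Proof.
have [_ Z0 _ _ _] := Zsolid; have [_ LZ _] := Locf.
by have := LZ 0 _ Z0; rewrite !mul0r.
Qed.

Lemma functional_sum (I : Type) (s : seq I) (G : I -> T -> R) :
  (forall i, Z (G i)) ->
  Z (fun x => \sum_(i <- s) G i x) /\
  L (fun x => \sum_(i <- s) G i x) = \sum_(i <- s) L (G i).
Proof.
have [_ Z0 ZD _ _] := Zsolid; have [LD _ _] := Locf.
move=> ZG; elim: s => [|i s [Zs Ls]].
  rewrite big_nil; under eq_fun do rewrite big_nil.
  by split=> //; exact: functional0.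
rewrite big_cons; under eq_fun do rewrite big_cons.
by split; [exact: ZD|rewrite LD// Ls].
Qed.

(** Level sets of nonzero values lie in [B], hence in the ideal, where [p] is given by [L]. The zero
    level set may fall outside the ideal, but its coefficient vanishes. *)
Lemma sintegral_functional (g : {nnsfun T >-> R}) B : Rg B ->
  (forall x, ~ B x -> g x = 0) -> sintegral p g = (L g)%:E.
Proof.
move=> RB gB; have [_ Z0 _ ZZ _] := Zsolid; have [_ LZ _] := Locf.
have [_ _ Rsub _] := RgI.
have Rgr r : r != 0 -> Rg (g @^-1` [set r]).
  move=> r0; apply: (Rsub B) => // x /= gxr; apply: contrapT => /gB gx0.
  by move: r0; rewrite -gxr gx0 eqxx.
have term r : Z (fun x => r * \1_(g @^-1` [set r]) x) /\
    (L (fun x => r * \1_(g @^-1` [set r]) x))%:E = (r%:E * p (g @^-1` [set r]))%E.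
  have [->|r0] := eqVneq r 0.
    rewrite mul0e (_ : (fun x => _) = fun=> 0) ?functional0//.
    by apply/funext => x; rewrite mul0r.
  have Rr := Rgr _ r0.
  by split; [exact/ZZ/RgZ|rewrite LZ ?EFinM ?pE//; exact: RgZ].
rewrite sintegralE fsbig_finite//.
have [_] := functional_sum (finmap.enum_fset (fset_set (range g))) (fun r => (term r).1).
under eq_bigr do rewrite -(term _).2.
rewrite sumEFin => <-; congr (L _)%:E; apply/funext => x.
by rewrite [RHS]fimfunE fsbig_finite//.
Qed.

Lemma integralT_functional (f : T -> R) : sigma_covered Rg -> Z f ->
  (forall x, 0 <= f x) -> (\int[p]_x (f x)%:E)%E = (L f)%:E.
Proof.
move=> [U [RU UT]] Zf f0; have [mR R0 _ RUU] := RgI.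
have [Zm _ ZD ZZ Zs] := Zsolid; have [LD LZ Lc] := Locf.
have mf : measurable_fun setT (EFin \o f) by apply/measurable_EFinP; exact: Zm.
pose h := nnsfun_approx measurableT mf.
pose V n := \big[setU/set0]_(i < n) U i.
have RV n : Rg (V n).
  by rewrite /V; elim: n => [|n IH]; rewrite ?big_ord0// big_ord_recr; exact: RUU.
have mV n := mR _ (RV n).
(* Cutting off to [V n], a finite union of sets of the cover, puts the support in the ideal. Each
   point eventually lies in [V n], so the pointwise limit is still [f]. *)
pose g n := mul_nnsfun (h n) (indic_nnsfun R (mV n)).
have gE n x : g n x = h n x * \1_(V n) x by [].
have gV n x : V n x -> g n x = h n x by move=> Vx; rewrite gE indicE mem_set// mulr1.
have gNV n x : ~ V n x -> g n x = 0 by move=> Vx; rewrite gE indicE memNset// mulr0.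
have h_le x : {homo (fun n => h n x) : n m / (n <= m)%N >-> n <= m}.
  by move=> n m nm; exact: (lefP _ _ (nd_nnsfun_approx measurableT mf nm)).
have g_le x : {homo (fun n => g n x) : n m / (n <= m)%N >-> n <= m}.
  move=> n m nm; have [Vx|Vx] := pselect (V n x); last by rewrite gNV.
  by rewrite !gV//; [exact: h_le|exact: subset_bigsetU Vx].
have h_cvg x : h n x @[n --> \oo] --> f x.
  have := @cvg_nnsfun_approx _ _ _ _ measurableT _ mf (fun x _ => f0 x) x Logic.I.
  by move=> /fine_cvgP[].
have g_cvg x : g n x @[n --> \oo] --> f x.
  have [k _ Ukx] : (\bigcup_n U n) x by rewrite UT.
  apply: cvg_trans (h_cvg x); apply: near_eq_cvg; exists k.+1 => // n kn.
  by apply/esym/gV; rewrite /V -bigcup_mkord; exists k.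
have g_f n x : g n x <= f x.
  rewrite -(cvg_lim _ (g_cvg x))//; apply: nondecreasing_cvgn_le; first exact: g_le.
  by apply/cvg_ex; eexists; exact: g_cvg.
have Zg n : Z (g n).
  apply: (Zs f) => // x; rewrite !ger0_norm//.
have gL n : sintegral p (g n) = (L (g n))%:E by exact: sintegral_functional (gNV n).
have Lg_cvg : L (g n) @[n --> \oo] --> L f.
  (* Order continuity concerns sequences decreasing to 0, hence the passage to [f - g n]. *)
  have Zfg n : Z (fun x => f x + (-1) * g n x) by exact/ZD/ZZ.
  have Lfg n : L (fun x => f x + (-1) * g n x) = L f - L (g n).
    by rewrite LD ?LZ ?mulN1r//; exact: ZZ.
  have : L f - L (g n) @[n --> \oo] --> 0.
    under eq_fun do rewrite -Lfg; apply: Lc => // [n x|x].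
      by rewrite lerD2l !mulN1r lerN2; exact: g_le.
    under eq_fun do rewrite mulN1r; rewrite -(subrr (f x)).
    by apply: cvgB; [exact: cvg_cst|exact: g_cvg].
  move=> c0; rewrite -[X in _ --> X]subr0.
  under eq_fun do rewrite -(subKr (L f) (L (g _))).
  by apply: cvgB c0; exact: cvg_cst.
have -> : (\int[p]_x (f x)%:E)%E = limn (sintegral p \o (fun n => g n : T -> R)).
  apply: nd_ge0_integral_lim => //.
  by move=> x; apply: cvg_EFin; [exact: nearW|exact: g_cvg].
have -> : sintegral p \o (fun n => g n : T -> R) = fun n => (L (g n))%:E.
  by apply/funext => n; exact: gL.
by apply/cvg_lim => //; apply: cvg_EFin; [exact: nearW|exact: Lg_cvg].
Qed.

Lemma solid_space_mul_indic (f : T -> R) A : Z f -> measurable A ->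
  Z (fun x => f x * \1_A x).
Proof.
move=> Zf mA; have [Zm _ _ _ Zs] := Zsolid; apply: (Zs f) => //.
  by apply: measurable_funM; [exact: Zm|exact: measurable_indic].
by move=> x; rewrite indicE; case: (x \in A); rewrite ?mulr1// mulr0 normr0.
Qed.

Lemma solid_space_funrpos (f : T -> R) : Z f -> Z f^\+.
Proof.
move=> Zf; have [Zm _ _ _ Zs] := Zsolid; apply: (Zs f) => //.
  by apply: measurable_funrpos; exact: Zm.
move=> x; rewrite ger0_norm ?funrpos_ge0// /funrpos ge_max normr_ge0 andbT.
exact: ler_norm.
Qed.

Lemma solid_space_funrneg (f : T -> R) : Z f -> Z f^\-.
Proof.
move=> Zf; have [Zm _ _ _ Zs] := Zsolid; apply: (Zs f) => //.
  by apply: measurable_funrneg; exact: Zm.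
move=> x; rewrite ger0_norm ?funrneg_ge0// /funrneg ge_max normr_ge0 andbT.
by rewrite -normrN ler_norm.
Qed.

Lemma integral_functional (f : T -> R) A : sigma_covered Rg -> Z f ->
  (forall x, 0 <= f x) -> measurable A ->
  (\int[p]_(x in A) (f x)%:E)%E = (L (fun x => f x * \1_A x))%:E.
Proof.
move=> cov Zf f0 mA.
rewrite -integralT_functional//; last 2 first.
- exact: solid_space_mul_indic.
- by move=> x; rewrite mulr_ge0.
rewrite integral_mkcond; apply: eq_integral => x _.
by rewrite patchE indicE; case: ifP => _; rewrite ?mulr1// mulr0.
Qed.

Lemma integral_functional_real (f : T -> R) A : sigma_covered Rg -> Z f ->
  measurable A -> (\int[p]_(x in A) (f x)%:E)%E = (L (fun x => f x * \1_A x))%:E.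
Proof.
move=> cov Zf mA; have [_ _ _ ZZ _] := Zsolid; have [LD LZ _] := Locf.
have Zp := solid_space_mul_indic (solid_space_funrpos Zf) mA.
have Zn := solid_space_mul_indic (solid_space_funrneg Zf) mA.
rewrite integralE -/(EFin \o f) funerpos funerneg.
rewrite (integral_functional cov (solid_space_funrpos Zf))//.
rewrite (integral_functional cov (solid_space_funrneg Zf))//.
rewrite -EFinB -mulN1r -LZ// -LD//; last exact: ZZ.
congr (L _)%:E; apply/funext => x; rewrite -[in RHS](funrposBneg f) /=.
by rewrite mulN1r -mulrBl.
Qed.

End integral_of_functional.

Lemma order_continuous_functionalN (T : Type) (R : realType) (Z : set (T -> R))
    (L : (T -> R) -> R) :
  order_continuous_functional Z L ->
  order_continuous_functional Z (fun f => - L f).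
Proof.
move=> [LD LZ Lc]; split=> [f g Zf Zg|a f Zf|u Zu u_dec u0].
- by rewrite LD// opprD.
- by rewrite LZ// mulrN.
- by rewrite -oppr0; apply: cvgN; exact: Lc.
Qed.

(** * Set functions induced by order continuous functionals *)

Section functional_on_ideal.
Context d (T : measurableType d) (R : realType).
Variables (Z : set (T -> R)) (L : (T -> R) -> R) (Rg : set (set T)).
Hypotheses (Zsolid : solid_space Z) (Locf : order_continuous_functional Z L).
Hypotheses (RgI : ring_ideal Rg) (RgZ : forall B, Rg B -> Z (\1_B)).

Lemma order_continuous_functional_restrict Q : measurable Q ->
  order_continuous_functional Z (fun f => L (fun x => f x * \1_Q x)).
Proof.
move=> mQ; have [LD LZ Lc] := Locf.
have ZQ f : Z f -> Z (fun x => f x * \1_Q x).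
  by move=> Zf; exact: solid_space_mul_indic.
split=> [f g Zf Zg|a f Zf|u Zu u_dec u0].
- rewrite -LD; [|exact: ZQ|exact: ZQ].
  by congr L; apply/funext => x; rewrite mulrDl.
- rewrite -LZ; last exact: ZQ.
  by congr L; apply/funext => x; rewrite mulrA.
- apply: Lc => [n|n x|x]; first exact: ZQ.
    by rewrite ler_wpM2r.
  by rewrite -[X in _ --> X](mul0r (\1_Q x : R)); apply: cvgMl; exact: u0.
Qed.

Variable lam : set T -> R.
Hypothesis lamE : forall B, Rg B -> lam B = L (\1_B).

Lemma additive_on_functional : additive_on Rg lam.
Proof.
move=> A B RA RB AB; have [_ _ _ RU] := RgI; have [LD _ _] := Locf.
rewrite !lamE//; last exact: RU.
rewrite -LD; [|exact: RgZ|exact: RgZ].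
congr L; apply/funext => x; rewrite !indicE in_setU.
have [xA|xA] := boolP (x \in A); have [xB|xB] := boolP (x \in B) => /=;
  rewrite ?addr0 ?add0r//.
by have : (A `&` B) x; [split; exact: set_mem|rewrite AB].
Qed.

(** The indicators of the tails [U \ V n] decrease to 0 pointwise, so order continuity sends
    [lam (U \ V n)], which is [lam U] minus a partial sum, to 0. *)
Lemma sigma_additive_on_functional : sigma_additive_on Rg lam.
Proof.
move=> F RF tF RU; have [mR R0 _ RgU] := RgI; have [_ _ Lc] := Locf.
have lamD := additive_on_functional.
set U := \bigcup_n F n; pose V n := \big[setU/set0]_(i < n) F i.
have RV n : Rg (V n).
  by rewrite /V; elim: n => [|n IH]; rewrite ?big_ord0// big_ord_recr; exact: RgU.
have VU n : V n `<=` U by exact: bigsetU_bigcup.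
have lamV n : lam (V n) = \sum_(0 <= i < n) lam (F i).
  rewrite big_mkord /V; elim: n => [|n IH].
    by rewrite !big_ord0 (additive_on_set0 R0 lamD).
  rewrite !big_ord_recr /= lamD ?IH//; first exact: RV.
  by rewrite (@trivIset_bigsetUI _ predT)//; exact: sub_trivIset tF.
have lamUV n : lam (U `\` V n) = lam U - \sum_(0 <= i < n) lam (F i).
  rewrite (additive_on_split RgI lamD RU (mR _ (RV n))) -lamV (setIidr (VU n)); lra.
have RUV n : Rg (U `\` V n) by apply: ring_ideal_setD => //; exact: mR.
have c0 : lam (U `\` V n) @[n --> \oo] --> 0.
  under eq_fun do rewrite lamE//.
  apply: Lc => [n|n x|x]; first exact: RgZ.
    rewrite !indicE ler_nat.
    have [xV|//] := boolP (x \in U `\` V n.+1); rewrite mem_set//.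
    move: xV => /set_mem[Ux nVx]; split=> // Vx; apply: nVx.
    exact: subset_bigsetU Vx.
  have [[k _ Fkx]|nUx] := pselect (U x); apply: cvg_near_cst.
    exists k.+1 => // n /= kn; rewrite indicE memNset//= => -[_]; apply.
    by rewrite /V -bigcup_mkord; exists k.
  by apply: nearW => n; rewrite indicE memNset//= => -[].
rewrite -[X in _ --> X]subr0.
under eq_fun do rewrite -(subKr (lam U) (\sum_(0 <= i < _) _)) -lamUV.
by apply: cvgB c0; exact: cvg_cst.
Qed.

(* The variations of [lam] are represented by [L] localized to the two parts of
   a Hahn decomposition, so that integrals against them are values of [L]. *)
Lemma jordan_functional : sigma_covered Rg ->
  exists p q : {measure set T -> \bar R}, exists Lp Ln : (T -> R) -> R,
  [/\ (p : set T -> \bar R) = posvar Rg lam /\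
      (q : set T -> \bar R) = negvar Rg lam,
      order_continuous_functional Z Lp /\ order_continuous_functional Z Ln,
      (forall B, Rg B -> p B = (Lp (\1_B))%:E),
      (forall B, Rg B -> q B = (Ln (\1_B))%:E) &
      (forall f, Z f -> L f = Lp f - Ln f)].
Proof.
move=> cov; have lamD := additive_on_functional.
have lams := sigma_additive_on_functional.
have [P [mP lamP lamN]] := hahn_decomposition_on RgI cov lamD lams.
have [p pE] := posvar_measure RgI lamD lams.
have [q qE] := posvar_measure RgI (additive_onN lamD) (sigma_additive_onN lams).
have mNP : measurable (~` P) by exact: measurableC.
have LQ Q B : measurable Q -> Rg B -> lam (B `&` Q) = L (fun x => \1_B x * \1_Q x).
  move=> mQ RB; rewrite lamE; last exact: ring_ideal_setI.
  by rewrite indicI.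
exists p, q, (fun f => L (fun x => f x * \1_P x)),
  (fun f => - L (fun x => f x * \1_(~` P) x)); split.
- by [].
- split; first exact: order_continuous_functional_restrict.
  exact/order_continuous_functionalN/order_continuous_functional_restrict.
- by move=> B RB; rewrite pE (posvar_hahn RgI lamD mP)// LQ.
- move=> B RB; rewrite qE (posvar_hahn RgI (additive_onN lamD) mNP) ?LQ//.
  + by move=> C RC CP; rewrite oppr_ge0; exact: lamN.
  + by move=> C RC; rewrite setCK => CP; rewrite oppr_le0; exact: lamP.
- move=> f Zf; have [LD _ _] := Locf; rewrite opprK -LD.
  + congr L; apply/funext => x; rewrite -mulrDr !indicE in_setC.
    by case: (x \in P); rewrite ?addr0 ?add0r mulr1.
  + exact: solid_space_mul_indic.
  + exact: solid_space_mul_indic.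
Qed.

(** Both integrals in [sint] are real values, of [Lp] and [Ln] at [f] cut off to [A], so their
    difference is never of the form oo - oo. *)
Lemma sint_functional (f : T -> R) A : sigma_covered Rg -> Z f -> measurable A ->
  sint Rg lam A f = (L (fun x => f x * \1_A x))%:E.
Proof.
move=> cov Zf mA.
have [p [q [Lp [Ln [[pE qE] [ocp ocn] pB qB LE]]]]] := jordan_functional cov.
rewrite /sint -pE -qE (integral_functional_real Zsolid ocp RgI RgZ pB)//.
rewrite (integral_functional_real Zsolid ocn RgI RgZ qB)// -EFinB LE//.
exact: solid_space_mul_indic.
Qed.

(** The variation is the sum of the measures [p] and [q], and [|f|] is in [Z] by solidity; the
    integral is therefore the real number [Lp |f| + Ln |f|]. *)
Lemma integral_variation_lty (f : T -> R) : sigma_covered Rg -> Z f ->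
  (\int[Defs.variation Rg lam]_t `|f t|%:E < +oo)%E.
Proof.
move=> cov Zf; have [Zm _ _ _ Zs] := Zsolid.
have [p [q [Lp [Ln [[pE qE] [ocp ocn] pB qB _]]]]] := jordan_functional cov.
have varE : Defs.variation Rg lam = measure_add p q.
  apply/funext => A; rewrite variationE//; last exact: additive_on_functional.
  by rewrite -pE -qE; exact/esym/measure_addE.
have mf : measurable_fun setT (fun t => `|f t|).
  by apply: measurableT_comp => //; exact: Zm.
have Zaf : Z (fun t => `|f t|) by apply: (Zs f) => // x; rewrite normr_id.
rewrite varE ge0_integral_measure_add//; last exact/measurable_EFinP.
rewrite (integralT_functional Zsolid ocp RgI RgZ pB)//.
by rewrite (integralT_functional Zsolid ocn RgI RgZ qB)// -EFinD ltry.
Qed.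

End functional_on_ideal.

(** * Continuous linear functionals *)

Section dual.
Context (R : realType) (E : normedModType R).
Implicit Types (x : E -> R) (u v : E).

Lemma is_dualD x u v : is_dual x -> x (u + v) = x u + x v.
Proof. by move=> [xlin _]; rewrite -[u in LHS]scale1r xlin mul1r. Qed.

Lemma is_dual0 x : is_dual x -> x 0 = 0.
Proof. by move=> dx; have := is_dualD 0 0 dx; rewrite addr0; lra. Qed.

Lemma is_dualZ x (a : R) u : is_dual x -> x (a *: u) = a * x u.
Proof. by move=> dx; rewrite -[a *: u]addr0 dx.1 is_dual0// addr0. Qed.

Lemma is_dualB x u v : is_dual x -> x (u - v) = x u - x v.
Proof. by move=> dx; rewrite -scaleN1r is_dualD// is_dualZ// mulN1r. Qed.

Lemma dual_ball_separates u v : (forall x, dual_ball x -> x u = x v) -> u = v.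
Proof.
move=> uv; apply/eqP; rewrite -subr_eq0 -normr_eq0.
have [x [xball <-]] := exists_norming_functional (u - v).
by rewrite is_dualB; [rewrite uv// subrr|exact: xball.1].
Qed.

End dual.

(** * Operators on quasi-Banach function spaces and their vector measures *)

Section quasi_Banach_function_space.
Context d (T : measurableType d) (R : realType).
Variables (mu : {measure set T -> \bar R}) (X : set (T -> R)) (N : (T -> R) -> R).
Hypothesis XN : is_qBFS mu X N.

Lemma is_qBFS_solid : solid_space X.
Proof.
have [[Xm [X0 XD XZ]] Xs _ _ _] := XN; split=> // f g Xf mg gf.
by apply: (Xs f) => //; exact: aeW.
Qed.

Lemma ring_ideal_SigmaX : ring_ideal (SigmaX X).
Proof.
have [Xm X0 XD XZ Xs] := is_qBFS_solid.
have XS (f : T -> R) A : X f -> measurable A ->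
    (forall t, (\1_A t : R) <= `|f t|) -> SigmaX X A.
  move=> Xf mA Af; split=> //; apply: (Xs f) => // t.
  by rewrite ger0_norm.
split=> [A []//||A B [mA XA] mB BA|A B [mA XA] [mB XB]].
- by apply: XS X0 _ _ => // t; rewrite indic0 normr0.
- apply: XS XA _ _ => // t; rewrite ger0_norm// !indicE ler_nat.
  by have [/set_mem/BA/mem_set ->|] := boolP (t \in B).
- apply: XS (XD _ _ XA XB) _ _; first exact: measurableU.
  move=> t; rewrite ger0_norm ?addr_ge0// !indicE in_setU -natrD ler_nat.
  by case: (t \in A); case: (t \in B).
Qed.

Lemma sigma_covered_SigmaX : sigma_prop X -> sigma_covered (SigmaX X).
Proof. by move=> [U [mU [UT XU]]]; exists U; split=> // n; split. Qed.

(** A sequence decreasing to 0 has quasi-norms tending to 0, and continuity of [S] at 0 followed by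
    that of [x] carries this to the values. *)
Lemma cont_lin_op_functional (E : normedModType R) (S : (T -> R) -> E) (x : E -> R) :
  sigma_oc mu X N -> cont_lin_op X N S -> is_dual x ->
  order_continuous_functional X (fun f => x (S f)).
Proof.
move=> Xoc [SD SZ Sc] dx; have [_ X0 _ _ _] := is_qBFS_solid.
have S0 : S (fun=> 0) = 0.
  by have := SZ 0 _ X0; rewrite scale0r mulr0.
split=> [f g Xf Xg|a f Xf|u Xu u_dec u0].
- by rewrite SD// is_dualD.
- by rewrite SZ// is_dualZ.
- have Su : S (u n) @[n --> \oo] --> (0 : E).
    apply/cvgrPdist_lt => /= e e0; have [del del0 Sdel] := Sc _ X0 _ e0.
    have Nu : N (u n) @[n --> \oo] --> (0 : R).
      by apply: Xoc => //; apply: aeW => t; split=> //; exact: u0.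
    have /cvgrPdist_lt/(_ _ del0) := Nu; apply: filterS => n /=.
    rewrite !sub0r !normrN => Nun; rewrite -[S (u n)]subr0 -S0; apply: Sdel => //.
    under eq_fun do rewrite subr0.
    exact: le_lt_trans (ler_norm _) Nun.
  by rewrite -(is_dual0 dx); apply: continuous_cvg => //; exact: dx.2.
Qed.

(** [Rg] and [m] stay abstract: they may come from a smaller space than [X], and only [mE] ties them
    to [S]. *)
Variables (E : normedModType R) (S : (T -> R) -> E).
Variables (Rg : set (set T)) (m : set T -> E).
Hypotheses (RgI : ring_ideal Rg) (RgX : forall B, Rg B -> X (\1_B)).
Hypotheses (Rgcov : sigma_covered Rg) (mE : forall B, Rg B -> m B = S (\1_B)).
Hypotheses (Xoc : sigma_oc mu X N) (Sop : cont_lin_op X N S).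

(** For [B] inside [A] the indicator of [B] vanishes almost everywhere, so its quasi-norm is 0. It
    is thus within every [del] of the zero function, and continuity forces [S] to vanish on it. *)
Lemma mnull_op A : measurable A -> mu A = 0%E -> mnull Rg m A.
Proof.
move=> mA muA x xball; have [_ SZ Sc] := Sop.
have [_ _ [N0 _ _] _ _] := XN; have [_ X0 _ _ _] := is_qBFS_solid.
have S0 : S (fun=> 0) = 0 by have := SZ 0 _ X0; rewrite scale0r mulr0.
have mB0 B : Rg B -> B `<=` A -> m B = 0.
  move=> RB BA; have XB := RgX RB.
  have NB : N (\1_B) = 0.
    apply/(N0 _ XB); exists A; split=> // t /= nBt; apply: contrapT => nAt.
    by apply: nBt; rewrite indicE memNset// => /BA.
  apply/eqP; rewrite -normr_le0 mE//; apply/ler_addgt0Pr => e e0; rewrite add0r.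
  have [del del0 Sdel] := Sc _ X0 _ e0.
  have := Sdel _ XB; rewrite S0 subr0 => SB; apply/ltW/SB.
  by under eq_fun do rewrite subr0; rewrite NB.
apply/eqP; rewrite eq_le; apply/andP; split.
  apply: ge_ereal_sup => _ [n [F [RF _ ->]]]; rewrite lee_fin big1// => i _.
  have [RFi FA] := RF _ (ltn_ord i).
  by rewrite /xm mB0// is_dual0 ?normr0//; exact: xball.1.
(* The empty family shows that the supremum is at least 0. *)
by apply: ereal_sup_ubound; exists 0%N, (fun=> set0); split => //; rewrite big_ord0.
Qed.

Lemma sint_op (x : E -> R) (f : T -> R) A : is_dual x -> X f -> measurable A ->
  sint Rg (xm x m) A f = (x (S (fun t => f t * \1_A t)))%:E.
Proof.
move=> dx Xf mA; apply: (sint_functional is_qBFS_solid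
  (cont_lin_op_functional Xoc Sop dx)) => //.
by move=> B RB; rewrite /xm mE.
Qed.

Lemma sub_vL1 : X `<=` vL1 Rg m.
Proof.
move=> f Xf; have [Xm _ _ _ _] := is_qBFS_solid; split; first exact: Xm.
- move=> x dx; apply: (integral_variation_lty is_qBFS_solid
    (cont_lin_op_functional Xoc Sop dx)) => //.
  by move=> B RB; rewrite /xm mE.
- move=> A mA; exists (S (fun t => f t * \1_A t)) => x dx.
  by rewrite sint_op.
Qed.

(** [S f] has the scalar integrals that define the vector integral, and by Hahn-Banach no other
    vector does. *)
Lemma Ivec_op f : X f -> Ivec Rg m f = S f.
Proof.
move=> Xf; have fT : (fun t => f t * \1_setT t) = f.
  by apply/funext => t; rewrite indicT mulr1.
apply: xget_unique => [x dx|e eS]; first by rewrite sint_op// fT.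
apply: dual_ball_separates => x xball; apply: EFin_inj.
by rewrite (eS x xball.1) sint_op ?fT//; exact: xball.1.
Qed.

End quasi_Banach_function_space.

(** * Norm bound for the vector integral *)

Section vector_integral.
Context d (T : measurableType d) (R : realType) (E : normedModType R).
Variables (Rg : set (set T)) (m : set T -> E).

(** Membership in [vL1], used on the whole space, supplies an integral, so [xget] does not fall back
    on its default 0. *)
Lemma Ivec_sint (f : T -> R) (x : E -> R) : vL1 Rg m f -> is_dual x ->
  (x (Ivec Rg m f))%:E = sint Rg (xm x m) setT f.
Proof.
move=> [_ _ fint] dx; rewrite /Ivec.
by have /(xgetPex 0)/(_ x dx) := fint _ measurableT.
Qed.

Hypothesis RgI : ring_ideal Rg.
Hypothesis mD : forall x, is_dual x -> additive_on Rg (xm x m).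
Hypothesis ms : forall x, is_dual x -> sigma_additive_on Rg (xm x m).

(** With [x] norming the difference of the two integrals, its norm becomes a scalar integral of
    [g - f], bounded by the integral of [|g - f|] against the variation of [x m]; this is one of the
    terms in the supremum [vL1norm]. *)
Lemma norm_IvecB_le (f g : T -> R) : vL1 Rg m f -> vL1 Rg m g ->
  (`|Ivec Rg m g - Ivec Rg m f|%:E <= vL1norm Rg m (fun t => (g t - f t)%R))%E.
Proof.
move=> L1f L1g.
have [x [xball xE]] := exists_norming_functional (Ivec Rg m g - Ivec Rg m f).
have dx := xball.1.
have [p pE] := posvar_measure RgI (mD dx) (ms dx).
have [q qE] := posvar_measure RgI (additive_onN (mD dx)) (sigma_additive_onN (ms dx)).
have varE : Defs.variation Rg (xm x m) = measure_add p q.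
  apply/funext => A; rewrite variationE//; last exact: mD.
  by rewrite measure_addE pE qE.
have var_int (h : T -> R) : measurable_fun setT h ->
    (\int[Defs.variation Rg (xm x m)]_t `|h t|%:E =
     \int[p]_t `|h t|%:E + \int[q]_t `|h t|%:E)%E.
  move=> mh; rewrite varE ge0_integral_measure_add//.
  by apply/measurable_EFinP; exact: measurableT_comp.
have integrable_pq (h : T -> R) : vL1 Rg m h ->
    p.-integrable setT (EFin \o h) /\ q.-integrable setT (EFin \o h).
  move=> [mh /(_ x dx)]; rewrite var_int// => hlt _.
  have mEh : measurable_fun setT (EFin \o h) by exact/measurable_EFinP.
  by split; apply/integrableP; split=> //=; apply: le_lt_trans hlt;
    [apply: leeDl|apply: leeDr]; exact: integral_ge0.
have [pf qf] := integrable_pq _ L1f; have [pg qg] := integrable_pq _ L1g.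
have [mf _ _] := L1f; have [mg _ _] := L1g.
have mgf : measurable_fun setT (fun t => g t - f t) by exact: measurable_funB.
have sintE (h : T -> R) : vL1 Rg m h ->
    (x (Ivec Rg m h))%:E = (\int[p]_t (h t)%:E - \int[q]_t (h t)%:E)%E.
  by move=> L1h; rewrite Ivec_sint// /sint -pE; congr (_ - integral _ _ _)%E.
have -> : `|Ivec Rg m g - Ivec Rg m f|%:E =
    `|\int[p]_t (g t - f t)%:E - \int[q]_t (g t - f t)%:E|%E.
  rewrite -(normr_id (_ - _)) -xE is_dualB// -abse_EFin EFinB !sintE//.
  rewrite !(integralB_EFin _ _ _)//.
  (* All four integrals are finite, so the rearrangement takes place among real numbers. *)
  have := integrable_fin_num measurableT pf; have := integrable_fin_num measurableT pg.
  have := integrable_fin_num measurableT qf; have := integrable_fin_num measurableT qg.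
  move=> /= /fineK <- /fineK <- /fineK <- /fineK <-.
  by rewrite -!EFinB; congr (`|_%:E|)%E; lra.
apply: le_trans (lee_abs_sub _ _) _.
apply: (@le_trans _ _ (\int[p]_t `|g t - f t|%:E + \int[q]_t `|g t - f t|%:E)%E).
  by apply: leeD; apply: le_abse_integral => //; exact/measurable_EFinP.
by rewrite -var_int//; apply: ereal_sup_ubound; exists x.
Qed.

End vector_integral.

(** * Factorization through the integration operator, and optimality *)

Theorem theorem5p1 (d : measure_display) (T : measurableType d) (R : realType)
    (mu : {measure set T -> \bar R})
    (X : set (T -> R)) (NX : (T -> R) -> R)
    (E : completeNormedModType R) (Top : (T -> R) -> E) :
  is_qBFS mu X NX -> sigma_oc mu X NX -> sigma_prop X ->
  cont_lin_op X NX Top ->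
  [/\ (* [i] : X(mu) -> L^1(m_T) is well defined *)
      (forall A, measurable A -> mu A = 0%E -> mnull (SigmaX X) (mT Top) A)
      /\ X `<=` vL1 (SigmaX X) (mT Top),
      (* T = I_{m_T} o [i] *)
      (forall f, X f -> Top f = Ivec (SigmaX X) (mT Top) f),
      (* I_{m_T} : L^1(m_T) -> E is continuous *)
      (forall f, vL1 (SigmaX X) (mT Top) f -> forall e : R, 0 < e ->
         exists2 del : R, 0 < del & forall g, vL1 (SigmaX X) (mT Top) g ->
           (vL1norm (SigmaX X) (mT Top) (fun t => (g t - f t)%R) < del%:E)%E ->
           `|Ivec (SigmaX X) (mT Top) g - Ivec (SigmaX X) (mT Top) f| < e) &
      (* optimality *)
      (forall (xi : {measure set T -> \bar R}) (Z : set (T -> R))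
              (NZ : (T -> R) -> R) (S : (T -> R) -> E),
         abs_cont xi mu -> is_qBFS xi Z NZ -> sigma_oc xi Z NZ ->
         X `<=` Z -> cont_lin_op Z NZ S ->
         (forall f, X f -> Top f = S f) ->
         [/\ (forall A, measurable A -> xi A = 0%E -> mnull (SigmaX X) (mT Top) A),
             Z `<=` vL1 (SigmaX X) (mT Top) &
             (forall g, Z g -> S g = Ivec (SigmaX X) (mT Top) g)])].
Proof.
move=> XN Xoc Xcov Top_op.
have RgI := ring_ideal_SigmaX XN; have Rgcov := sigma_covered_SigmaX Xcov.
have RgX B : SigmaX X B -> X (\1_B) by case.
have optimal (xi : {measure set T -> \bar R}) (Z : set (T -> R))
    (NZ : (T -> R) -> R) (S : (T -> R) -> E) :
    is_qBFS xi Z NZ -> sigma_oc xi Z NZ -> X `<=` Z -> cont_lin_op Z NZ S ->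
    (forall f, X f -> Top f = S f) ->
    [/\ forall A, measurable A -> xi A = 0%E -> mnull (SigmaX X) (mT Top) A,
        Z `<=` vL1 (SigmaX X) (mT Top) &
        forall g, Z g -> S g = Ivec (SigmaX X) (mT Top) g].
  move=> ZN Zoc XZ Sop TS.
  have RgZ B : SigmaX X B -> Z (\1_B) by move=> /RgX /XZ.
  have mE B : SigmaX X B -> mT Top B = S (\1_B) by move=> /RgX /TS.
  split=> [A|f Zf|g Zg].
  - exact: (mnull_op ZN RgZ mE Sop).
  - exact: (sub_vL1 ZN RgI RgZ Rgcov mE Zoc Sop).
  - by rewrite (Ivec_op ZN RgI RgZ Rgcov mE Zoc Sop).
(* The factorization of [Top] itself is the instance [Z = X], [S = Top]. *)
have [nullX subX TopE] := optimal _ _ _ _ XN Xoc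
  (@subset_refl _ X) Top_op (fun _ _ => erefl).
split=> //; last by move=> xi Z NZ S _; exact: optimal.
have mTE x : is_dual x -> forall B, SigmaX X B -> xm x (mT Top) B = x (Top (\1_B)) by [].
have ocx x (dx : is_dual x) := cont_lin_op_functional XN Xoc Top_op dx.
have mD x : is_dual x -> additive_on (SigmaX X) (xm x (mT Top)).
  by move=> dx; exact (additive_on_functional (ocx x dx) RgI RgX (mTE x dx)).
have ms x : is_dual x -> sigma_additive_on (SigmaX X) (xm x (mT Top)).
  by move=> dx; exact (sigma_additive_on_functional (ocx x dx) RgI RgX (mTE x dx)).
(* The integration operator is 1-Lipschitz, so [del = e] works. *)
move=> f L1f e e0; exists e => // g L1g lt_e.
by rewrite -lte_fin; apply: le_lt_trans lt_e; exact: norm_IvecB_le.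
Qed.
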